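(* For $n\ge 8$, $c_2(n,P_3)=1$, where $P_3$ is the linear $3$-path, the $3$-graph with vertex set $\{v_1,\dots,v_7\}$ and edges $\{v_1,v_2,v_3\},\{v_3,v_4,v_5\},\{v_5,v_6,v_7\}$.
   Context: For a $3$-graph $G$, $\delta_2(G)$ is the minimum over pairs of vertices of the number of edges containing the pair; $G$ has an $F$-covering if every vertex lies in a copy of $F$; $c_2(n,F)$ is the maximum of $\delta_2(G)$ over $n$-vertex $3$-graphs $G$ with no $F$-covering. *)

(* Defs.v *)
From HB Require Import structures.
From mathcomp Require Import all_boot.

Set Implicit Arguments.
Unset Strict Implicit.
Unset Printing Implicit Defensive.

Definition uniform3 (T : finType) (E : {set {set T}}) : bool :=
  [forall e in E, #|e| == 3].

Record trigraph (T : finType) : Type := TriGraph {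
  edges : {set {set T}};
  edges_uniform3 : uniform3 edges
}.

HB.instance Definition _ (T : finType) := [isSub for @edges T].
HB.instance Definition _ (T : finType) := [Finite of trigraph T by <:].

Definition codegree (T : finType) (G : trigraph T) (p : {set T}) : nat :=
  #|[set e in edges G | p \subset e]|.

(* The default value #|T| of the minimum is only reached when T has fewer than
   two elements: every codegree is at most #|T| - 2. *)
Definition delta2 (T : finType) (G : trigraph T) : nat :=
  \big[minn/#|T|]_(p : {set T} | #|p| == 2) codegree G p.

(* Copies are subgraphs, not necessarily induced. *)
Definition embedding (S T : finType) (F : trigraph S) (G : trigraph T)
    (f : {ffun S -> T}) : bool :=
  injectiveb f && [forall e in edges F, f @: e \in edges G].

Definition has_covering (S T : finType) (F : trigraph S) (G : trigraph T) :
    bool :=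
  [forall x : T, [exists f : {ffun S -> T}, embedding F G f && (x \in codom f)]].

(* Up to isomorphism, an n-vertex 3-graph has vertex set 'I_n.  The maximum is 0
   if there is no 3-graph without an F-covering; this does not happen when
   0 < n and F has an edge, by the edgeless 3-graph. *)
Definition c2 (n : nat) (S : finType) (F : trigraph S) : nat :=
  \max_(G : trigraph 'I_n | ~~ has_covering F G) delta2 G.

(* The vertex v_i of the path, for 1 <= i <= 7, is the ordinal i - 1. *)
Definition P3_edges : {set {set 'I_7}} :=
  [set [set inord 0; inord 1; inord 2];
       [set inord 2; inord 3; inord 4];
       [set inord 4; inord 5; inord 6]].

Lemma P3_uniform3 : uniform3 P3_edges.
Proof.
have c (i j k : nat) : i < j -> j < k -> k < 7 ->
    #|[set inord i; inord j; inord k] : {set 'I_7}| == 3.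
  move=> ij jk k7; have j7 := ltn_trans jk k7; have i7 := ltn_trans ij j7.
  rewrite setUC cardsU1 cards2 !inE -!val_eqE /= !inordK //.
  by rewrite (ltn_eqF ij) (gtn_eqF jk) (gtn_eqF (ltn_trans ij jk)).
by apply/forall_inP => e; rewrite !inE => /orP[/orP[]|] /eqP->; apply: c.
Qed.

Definition P3 : trigraph 'I_7 := TriGraph P3_uniform3.

(* Main.v *)
(** For the lower bound take the star: all triples through a fixed vertex.  The
    end edges of a linear 3-path are disjoint, so it contains none.

    For the upper bound let [x] be a vertex of a 3-graph on at least 8 vertices
    in which any two vertices have at least two common neighbours.  The link of
    [x] has minimum degree at least 2, so it contains disjoint edges [ab] and
    [cd]; let [W] be the rest of the vertices, [x] removed.  Assume that no path
    goes through [x].  Then no edge has one vertex in [abcd] and two in [W].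
    If the link has an edge [fg] in [W], let [k] be a third vertex of [W].
    As [fgx], [xdc], [cak] is no path, [kca] is not an edge, nor is [kcb]; so
    the only neighbours of the pair [kc] are [x] and [d].  Likewise [kab] is an
    edge, and [fgx], [xck], [kab] is a path.  Otherwise any [k] in [W] has a
    link neighbour in [abcd], say [c], and lies in an edge [kfg] inside [W], so
    [abx], [xck], [kfg] is a path. *)

Require Import Defs.
From mathcomp Require Import all_boot all_order.

Set Implicit Arguments.
Unset Strict Implicit.
Unset Printing Implicit Defensive.

Lemma exists_notin (T : finType) (s : seq T) :
  size s < #|T| -> exists y, y \notin s.
Proof.
move=> sT; apply/existsP; rewrite -negb_forall; apply: contraL sT => /forallP sP.
rewrite -leqNgt (leq_trans _ (card_size s)) //.
by apply/subset_leq_card/subsetP => y _; apply: sP.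
Qed.

Ltac split_uniq := repeat match goal with
  | H : is_true (uniq _) |- _ => move: H; rewrite /= ?inE ?negb_or
  | H : is_true (_ \notin _) |- _ => move: H; rewrite /= ?inE ?negb_or
  | |- is_true (_ && _) -> _ => case/andP
  | |- is_true (_ != _) -> _ => move/eqP => ?
  | |- is_true true -> _ => move=> _
  end.

Ltac distinct := split_uniq; rewrite /= ?inE ?negb_or;
  repeat (apply/andP; split); try (apply/eqP; congruence); try done.

Section PathThrough.
Variables (T : finType) (e : T -> T -> T -> bool).
Hypothesis eC : forall a b c, e a b c = e b a c.
Hypothesis eCA : forall a b c, e a b c = e a c b.
(** Codegree at least 2 in the form used below: a pair can be extended to an edge even when one
    vertex [z] is forbidden. With [z] in the pair this only asks for some extension. *)
Hypothesis e_ext : forall u v z, u != v ->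
  exists2 w, w \notin [:: u; v; z] & e u v w.
Hypothesis T8 : 8 <= #|T|.
Variable x : T.

Lemma e_rot a b c : e a b c = e c a b.
Proof. by rewrite eCA eC. Qed.

(** Greedy choice in the link of [x]. A fresh [c] has a neighbour other than [a]; if it is [b], a
    fresh [d] has a neighbour other than [b]; if that is [a], then [cb] and [da] are disjoint. *)
Lemma link_matching : exists a b c d,
  [/\ uniq [:: x; a; b; c; d], e x a b & e x c d].
Proof.
have fresh (s : seq T) : size s < 8 -> exists y, y \notin s.
  by move=> s8; apply/exists_notin/(leq_trans s8).
have [//|a xa] := fresh [:: x].
have [|b xab exab] := @e_ext x a a; first by distinct.
have [//|c xabc] := fresh [:: x; a; b].
have [|w xcw excw] := @e_ext x c a; first by distinct.
have [wb|/eqP wb] := eqVneq w b; last by exists a, b, c, w; split=> //; distinct.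
subst w.
have [//|d xabcd] := fresh [:: x; a; b; c].
have [|w xdw exdw] := @e_ext x d b; first by distinct.
have [wa|/eqP wa] := eqVneq w a; last by exists a, b, d, w; split=> //; distinct.
by subst w; exists c, b, d, a; split=> //; distinct.
Qed.

(** The indices mirror those of [P3_edges], so that [tnth s] serves directly as the embedding. *)
Definition path_through (s : 7.-tuple T) : Prop :=
  [/\ uniq s, x \in s,
      e (tnth s (inord 0)) (tnth s (inord 1)) (tnth s (inord 2)),
      e (tnth s (inord 2)) (tnth s (inord 3)) (tnth s (inord 4)) &
      e (tnth s (inord 4)) (tnth s (inord 5)) (tnth s (inord 6))].

Hypothesis no_path : forall s, ~ path_through s.

Lemma no_path7 v1 v2 v3 v4 v5 v6 v7 :
  uniq [:: v1; v2; v3; v4; v5; v6; v7] ->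
  x \in [:: v1; v2; v3; v4; v5; v6; v7] ->
  e v1 v2 v3 -> e v3 v4 v5 -> e v5 v6 v7 -> False.
Proof.
move=> Us xs e1 e2 e3; apply: (no_path (s := [tuple v1; v2; v3; v4; v5; v6; v7])).
by split=> //; rewrite !(tnth_nth x) /= !inordK.
Qed.

(** Otherwise [abx], [xdc], [cfg] is a path. Relabelling the matching gives the same for [a], [b]
    and [d]. *)
Lemma no_outgoing a b c d f g : uniq [:: x; a; b; c; d; f; g] ->
  e x a b -> e x c d -> ~ e c f g.
Proof.
move=> U exab excd ecfg.
apply: (@no_path7 a b x d c f g) => //; first by distinct.
- by rewrite !inE eqxx !orbT.
- by rewrite e_rot.
- by rewrite eCA.
Qed.

Lemma ext_outer a b c d f g k : uniq [:: x; a; b; c; d; f; g; k] ->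
  e x a b -> e x c d -> e x f g -> e k c x /\ e k c d.
Proof.
move=> U exab excd exfg.
have kc w : w \notin [:: k; c] -> e k c w -> w = x \/ w = d.
  have no_back a' b' : uniq [:: x; a'; b'; c; d; f; g; k] -> ~ e k c a'.
    move=> U' ekca; apply: (@no_path7 f g x d c a' k) => //; first by distinct.
    - by rewrite !inE eqxx !orbT.
    - by rewrite e_rot.
    - by rewrite eCA.
    - by rewrite e_rot.
  move=> wkc ekcw.
  have [->|/eqP wx] := eqVneq w x; first by left.
  have [->|/eqP wd] := eqVneq w d; first by right.
  have [wa|/eqP wa] := eqVneq w a.
    by subst w; case: (@no_back a b).
  have [wb|/eqP wb] := eqVneq w b.
    by subst w; case: (@no_back b a) => //; distinct.
  by case: (@no_outgoing a b c d k w) => //; [distinct|rewrite eC].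
(* Only [x] and [d] can extend the pair [kc], so forbidding either one forces the other. *)
split.
- have [|w wk ew] := @e_ext k c d; first by distinct.
  have [|<- //|wd] := kc w _ ew; first by distinct.
  by move: wk; rewrite wd !inE eqxx !orbT.
have [|w wk ew] := @e_ext k c x; first by distinct.
have [|wx|<- //] := kc w _ ew; first by distinct.
by move: wk; rewrite wx !inE eqxx !orbT.
Qed.

Lemma no_third_link_edge a b c d f g : uniq [:: x; a; b; c; d; f; g] ->
  e x a b -> e x c d -> ~ e x f g.
Proof.
move=> U exab excd exfg.
(* The bound 8 is used in full here: [k] is an eighth vertex. *)
have [//|k kP] := @exists_notin T [:: x; a; b; c; d; f; g].
have [|ekcx _] := @ext_outer a b c d f g k _ exab excd exfg; first by distinct.
(* Exchanging the two matching edges turns [kcd] into [kab]. *)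
have [|_ ekab] := @ext_outer c d a b f g k _ excd exab exfg; first by distinct.
apply: (@no_path7 f g x c k a b) => //; first by distinct.
- by rewrite !inE eqxx !orbT.
- by rewrite e_rot.
- by rewrite e_rot eCA.
Qed.

Lemma no_link_edge_out a b c d k : uniq [:: x; a; b; c; d; k] ->
  e x a b -> e x c d -> ~ e x k c.
Proof.
move=> U exab excd exkc.
have [|f fP] := @exists_notin T [:: x; a; b; c; d; k]; first exact: ltnW.
have [|g gP ekfg] := @e_ext k f x; first by distinct.
have exba : e x b a by rewrite eCA.
have exdc : e x d c by rewrite eCA.
have efkg := ekfg; rewrite eC in efkg.
have egkf := ekfg; rewrite e_rot in egkf.
(* If [g] lay in the matching, [kfg] would have one vertex there and two outside, against
   [no_outgoing]. *)
have [ga|/eqP ga] := eqVneq g a.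
  by subst g; case: (@no_outgoing c d a b k f) => //; distinct.
have [gb|/eqP gb] := eqVneq g b.
  by subst g; case: (@no_outgoing c d b a k f) => //; distinct.
have [gc|/eqP gc] := eqVneq g c.
  by subst g; case: (@no_outgoing a b c d k f) => //; distinct.
have [gd|/eqP gd] := eqVneq g d.
  by subst g; case: (@no_outgoing a b d c k f) => //; distinct.
apply: (@no_path7 a b x c k f g) => //; first by distinct.
- by rewrite !inE eqxx !orbT.
- by rewrite e_rot.
- by rewrite eCA.
Qed.

Lemma some_path : False.
Proof.
have [a [b [c [d [U exab excd]]]]] := link_matching.
have exba : e x b a by rewrite eCA.
have exdc : e x d c by rewrite eCA.
have [|k kP] := @exists_notin T [:: x; a; b; c; d]; first by do 2 apply: ltnW.
have [|w wP exkw] := @e_ext x k x; first by distinct.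
have [wa|/eqP wa] := eqVneq w a.
  by subst w; case: (@no_link_edge_out c d a b k) => //; distinct.
have [wb|/eqP wb] := eqVneq w b.
  by subst w; case: (@no_link_edge_out c d b a k) => //; distinct.
have [wc|/eqP wc] := eqVneq w c.
  by subst w; case: (@no_link_edge_out a b c d k) => //; distinct.
have [wd|/eqP wd] := eqVneq w d.
  by subst w; case: (@no_link_edge_out a b d c k) => //; distinct.
by case: (@no_third_link_edge a b c d k w) => //; distinct.
Qed.

End PathThrough.

Lemma delta2_le_codegree (T : finType) (G : trigraph T) (p : {set T}) :
  #|p| == 2 -> delta2 G <= codegree G p.
Proof.
move=> p2; rewrite /delta2 -minEnat -leEnat.
exact: (Order.TotalTheory.bigmin_le_cond _ (codegree G) p2).
Qed.

(** At least two edges contain the pair, and at most one of them is the triple through [z]; any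
    other one serves. *)
Lemma delta2_gt1_ext (T : finType) (G : trigraph T) (u v z : T) :
  1 < delta2 G -> u != v ->
  exists2 w, w \notin [:: u; v; z] & [set u; v; w] \in edges G.
Proof.
move=> G2 uv; have uv2 : #|[set u; v]| == 2 by rewrite cards2 uv.
have := leq_trans G2 (delta2_le_codegree G uv2); rewrite /codegree.
set A := [set _ in _ | _] => A2.
have /card_gt0P[h] : 0 < #|A :\ [set u; v; z]|.
  by move: A2; rewrite (cardsD1 [set u; v; z]); case: (_ \in A) => // /ltnW.
rewrite !inE => /and3P[hz hG uvh].
have /eqP h3 := forall_inP (edges_uniform3 G) _ hG.
have /cards1P[w hw] : #|h :\: [set u; v]| == 1.
  by rewrite cardsD (setIidPr uvh) h3 (eqP uv2).
have hE : h = [set u; v; w] by rewrite -hw setDE setUIr setUCr setIT; apply/esym/setUidPr.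
exists w; last by rewrite -hE.
have : w \in h :\: [set u; v] by rewrite hw set11.
rewrite !inE !negb_or => /andP[/andP[-> ->] _] /=.
by apply: contraNneq hz => <-; rewrite hE.
Qed.

Lemma delta2_gt1_covering (T : finType) (G : trigraph T) :
  8 <= #|T| -> 1 < delta2 G -> has_covering P3 G.
Proof.
move=> T8 G2; apply/forallP => x; apply: contraT => nx.
pose e a b c := [set a; b; c] \in edges G.
case: (@some_path T e _ _ _ T8 x).
- by move=> a b c; rewrite /e (setUC [set a]).
- by move=> a b c; rewrite /e setUAC.
- by move=> u v z; apply: delta2_gt1_ext.
move=> s [Us xs e1 e2 e3]; apply: (negP nx); apply/existsP.
exists [ffun i => tnth s i]; apply/andP; split; last first.
  by have /tnthP[i ->] := xs; apply/codomP; exists i; rewrite ffunE.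
apply/andP; split.
  by apply/injectiveP => i j; rewrite !ffunE => /(tuple_uniqP _ Us).
apply/forall_inP => h; rewrite !inE => /orP[/orP[]|] /eqP->;
  by rewrite !imsetU !imset_set1 !ffunE.
Qed.

Section Star.
Variables (T : finType) (x : T).

Definition star_edges : {set {set T}} := [set h : {set T} | (#|h| == 3) && (x \in h)].

Lemma star_uniform3 : uniform3 star_edges.
Proof. by apply/forall_inP => h; rewrite inE => /andP[]. Qed.

Definition star : trigraph T := TriGraph star_uniform3.

Lemma star_P3_free (f : {ffun 'I_7 -> T}) : ~~ embedding P3 star f.
Proof.
apply/negP => /andP[/injectiveP f_inj /forall_inP fE].
have /fE : [set inord 0; inord 1; inord 2] \in edges P3 by rewrite !inE eqxx.
have /fE : [set inord 4; inord 5; inord 6] \in edges P3 by rewrite !inE eqxx !orbT.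
(* The centre lies in the images of both end edges, so by injectivity these edges would share an
   index. *)
rewrite !inE => /andP[_ /imsetP[i iP ->]] /andP[_ /imsetP[j jP]] /f_inj ij.
move: iP jP; rewrite -{}ij !inE -!val_eqE /= !inordK //.
by case: i => /= m _; do 7 case: m => [|m] //.
Qed.

Lemma delta2_star_gt0 : 2 < #|T| -> 0 < delta2 star.
Proof.
move=> T3; rewrite /delta2; elim/big_ind: _ => [|m k m0 k0|p /eqP p2].
(* The default value [#|T|] of the minimum must be positive too. *)
- by do 2 apply: ltnW.
- by rewrite leq_min m0.
apply/card_gt0P.
(* A pair missing the centre is completed by it; a pair containing it, by any other vertex. *)
have [w wp xw] : exists2 w, w \notin p & x \in w |: p.
  have [xp|xp] := boolP (x \in p); last by exists x; rewrite ?setU11.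
  have [|w] := @exists_notin T (enum p); first by rewrite -cardE p2.
  by rewrite mem_enum => wp; exists w; rewrite // inE xp orbT.
by exists (w |: p); rewrite !inE cardsU1 wp p2 /= subsetUr andbT -in_setU1.
Qed.

End Star.

Theorem theorem9 (n : nat) (hn : 8 <= n) : c2 n P3 = 1.
Proof.
apply/eqP; rewrite eqn_leq; apply/andP; split.
  apply/bigmax_leqP => G; rewrite leqNgt; apply: contra => G2.
  by apply: delta2_gt1_covering; rewrite ?card_ord.
have n0 : 0 < n by apply: leq_trans hn.
pose x := Ordinal n0.
have star_free : ~~ has_covering P3 (star x).
  rewrite negb_forall; apply/existsP; exists x; rewrite negb_exists.
  by apply/forallP => f; rewrite (negbTE (star_P3_free _ _)).
apply: (@leq_trans (delta2 (star x))); last exact: leq_bigmax_cond.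
by apply: delta2_star_gt0; rewrite card_ord; apply: leq_trans hn.
Qed.
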